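(* Let $(M,\langle\,,\rangle,e^{-f}d\mathrm{vol})$ be a weighted Riemannian manifold and assume that there exists a non-negative $C^2$ function $\gamma$ on $M$ satisfying the following conditions: $$\gamma(x)\to+\infty\ \text{ as }x\to\infty;$$ $$\exists A>0\ \text{such that}\ |\nabla\gamma|\le A\gamma^{1/2}\ \text{off a compact set};$$ $$\exists B>0\ \text{such that}\ \Delta_f\gamma\le B\gamma^{1/2}G(\gamma^{1/2})^{1/2}\ \text{off a compact set};$$ $$\exists C>0\ \text{such that}\ |\nabla f|\le C\,G(\gamma^{1/2})^{1/2},$$ where $G$ is a smooth function on $[0,+\infty)$ satisfying: (i) $G(0)>0$; (ii) $G'(t)\ge0$ on $[0,+\infty)$; (iii) $G(t)^{-1/2}\notin L^1(+\infty)$; (iv) $\limsup_{t\to+\infty}\frac{t\,G(t^{1/2})}{G(t)}<+\infty$. Then, given any function $u\in C^2(M)$ with $u^*=\sup_Mu<+\infty$, there exists a sequence $\{x_k\}\subset M$ such that $$u(x_k)>u^*-\frac1k,\qquad|\nabla u(x_k)|<\frac1k,\qquad\Delta_fu(x_k)<\frac1k$$ for each $k\in\mathbb{N}$; i.e. the Omori-Yau maximum principle for $\Delta_f$ holds on $(M,\langle\,,\rangle,e^{-f}d\mathrm{vol})$.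
   Context: $(M,\langle\,,\rangle)$ is a connected Riemannian manifold, $f\in C^\infty(M)$, and $(M,\langle\,,\rangle,e^{-f}d\mathrm{vol})$ the associated weighted manifold. $\Delta_fu=\Delta u-\langle\nabla f,\nabla u\rangle$. $x\to\infty$ means that $x$ eventually leaves every compact subset of $M$. $G^{-1/2}\notin L^1(+\infty)$ means that $G^{-1/2}$ is not integrable at infinity. $k$ runs over the positive integers. *)

(* Defs.v *)
(* Smooth manifolds given by an atlas, Riemannian metrics given by their
   components in the charts, and the weighted Laplacian, over MathComp-Analysis. *)
From HB Require Import structures.
From mathcomp Require Import all_boot all_order all_algebra.
From mathcomp Require Import all_classical all_reals all_analysis.
Set Implicit Arguments.
Unset Strict Implicit.
Unset Printing Implicit Defensive.
Import Order.TTheory GRing.Theory Num.Theory.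
Import numFieldNormedType.Exports.
Local Open Scope classical_set_scope.
Local Open Scope ring_scope.

Section euclidean_calculus.
Variables (R : realType) (n : nat).
Implicit Types (U : set 'rV[R]_n) (h : 'rV[R]_n -> R).

Definition partial (i : 'I_n) h : 'rV[R]_n -> R :=
  fun y => 'D_(delta_mx 0 i) h y.

(* Meant for open U. *)
Fixpoint Ck_on (k : nat) U h : Prop :=
  {in U, continuous h} /\
  if k is k'.+1 then
    (forall i y, U y -> derivable h y (delta_mx 0 i)) /\
    (forall i, Ck_on k' U (partial i h))
  else True.

Definition smooth_on U h : Prop := forall k, Ck_on k U h.

End euclidean_calculus.

(* A homeomorphism from the open set [dom] onto an open subset of R^n.  [coord]
   and [param] are total functions, but only their values on [dom] and on
   [coord @` dom], respectively, are constrained and ever used. *)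
Record chart (R : realType) (n : nat) (M : topologicalType) := Chart {
  dom : set M ;
  coord : M -> 'rV[R]_n ;
  param : 'rV[R]_n -> M ;
  dom_open : open dom ;
  codom_open : open (coord @` dom) ;
  coordK : {in dom, cancel coord param} ;
  coord_continuous : {in dom, continuous coord} ;
  param_continuous : {in coord @` dom, continuous param}
}.

Definition codom (R : realType) (n : nat) (M : topologicalType)
  (c : chart R n M) : set 'rV[R]_n := coord c @` dom c.

Definition overlap (R : realType) (n : nat) (M : topologicalType)
  (c d : chart R n M) : set 'rV[R]_n := coord c @` (dom c `&` dom d).

Definition transition (R : realType) (n : nat) (M : topologicalType)
  (c d : chart R n M) : 'rV[R]_n -> 'rV[R]_n := coord d \o param c.

Record smooth_manifold (R : realType) (n : nat) (M : topologicalType) :=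
  SmoothManifold {
  atlas : set (chart R n M) ;
  manifold_hausdorff : hausdorff_space M ;
  manifold_second_countable : @second_countable M ;
  atlas_cover : forall x : M, exists2 c, atlas c & dom c x ;
  atlas_smooth : forall c d, atlas c -> atlas d -> forall a : 'I_n,
    smooth_on (overlap c d) (fun y => transition c d y 0 a)
}.

(* [gram c y] is the matrix (g_ij) of the metric at the point [param c y] in the
   coordinates of [c].  Tangent vectors are row vectors, so that
   [v *m jacobian F y] is the differential of [F] at [y] applied to [v] and the
   last field says that transition maps are isometries, i.e. that the g_ij are
   the components of a (0,2)-tensor field. *)
Record riemannian_manifold (R : realType) (n : nat) (M : topologicalType) :=
  RiemannianManifold {
  manifold_of :> smooth_manifold R n M ;
  gram : chart R n M -> 'rV[R]_n -> 'M[R]_n ;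
  gram_sym : forall c y, atlas manifold_of c -> codom c y ->
    (gram c y)^T = gram c y ;
  gram_posdef : forall c y (v : 'rV[R]_n), atlas manifold_of c -> codom c y ->
    v != 0 -> 0 < (v *m gram c y *m v^T) 0 0 ;
  gram_smooth : forall c i j, atlas manifold_of c ->
    smooth_on (codom c) (fun y => gram c y i j) ;
  gram_transition : forall c d y,
    atlas manifold_of c -> atlas manifold_of d -> overlap c d y ->
    gram c y = jacobian (transition c d) y *m gram d (transition c d y)
               *m (jacobian (transition c d) y)^T
}.

Section manifold_functions.
Variables (R : realType) (n : nat) (M : topologicalType).
Variable X : smooth_manifold R n M.

Definition Ck (k : nat) (u : M -> R) : Prop :=
  forall c, atlas X c -> Ck_on k (codom c) (u \o param c).

Definition smooth (u : M -> R) : Prop := forall k, Ck k u.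

(* A chart of the atlas around x.  Everything evaluated through it below
   (scalar products, Laplacians) has the same value in all such charts. *)
Definition chart_at (x : M) : chart R n M := sval (cid2 (atlas_cover X x)).

End manifold_functions.

Section riemannian_operators.
Variables (R : realType) (n : nat) (M : topologicalType).
Variable X : riemannian_manifold R n M.
Implicit Types (c : chart R n M) (u f : M -> R).

(* Components (grad u)^j = \sum_i g^ij d_i u of the gradient in the chart c. *)
Definition grad_in c u : 'rV[R]_n -> 'rV[R]_n :=
  fun y => (\row_i partial i (u \o param c) y) *m invmx (gram X c y).

(* div V = (det g)^(-1/2) \sum_i d_i ((det g)^(1/2) V^i). *)
Definition div_in c (V : 'rV[R]_n -> 'rV[R]_n) : 'rV[R]_n -> R :=
  fun y => (Num.sqrt (\det (gram X c y)))^-1 *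
    \sum_i partial i (fun z => Num.sqrt (\det (gram X c z)) * V z 0 i) y.

(* The tangent space at x, in the coordinates of [chart_at X x]. *)
Definition inner (x : M) (v w : 'rV[R]_n) : R :=
  (v *m gram X (chart_at X x) (coord (chart_at X x) x) *m w^T) 0 0.

Definition tnorm (x : M) (v : 'rV[R]_n) : R := Num.sqrt (inner x v v).

Definition grad u (x : M) : 'rV[R]_n :=
  grad_in (chart_at X x) u (coord (chart_at X x) x).

Definition laplacian u (x : M) : R :=
  div_in (chart_at X x) (grad_in (chart_at X x) u) (coord (chart_at X x) x).

Definition weighted_laplacian f u (x : M) : R :=
  laplacian u x - inner x (grad f x) (grad u x).

End riemannian_operators.

(* The complements of compact sets; the improper filter if M is compact. *)
Definition at_infinity (M : topologicalType) : set_system M :=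
  [set A | exists2 K : set M, compact K & ~` K `<=` A].
Arguments at_infinity M : clear implicits.

Section half_line.
Variable R : realType.
Implicit Types (G : R -> R) (t : R).

(* Derivatives relative to [0, +oo[ (one-sided at 0): the values of G at
   negative arguments are irrelevant. *)
Definition halfline_slope G t : R -> R := fun s => (G s - G t) / (s - t).

Definition halfline_filter t : set_system R := within `[0, +oo[ t^'.

Definition halfline_derive G : R -> R :=
  fun t => lim (halfline_slope G t @ halfline_filter t).

Definition halfline_smooth G : Prop := forall (k : nat) t, 0 <= t ->
  cvg (halfline_slope (iter k halfline_derive G) t @ halfline_filter t).

Definition integrable_at_pinfty (h : R -> R) : Prop :=
  exists a : R, (@lebesgue_measure R).-integrable `[a, +oo[ (EFin \o h).

End half_line.

(* Main.v *)
Require Import Defs.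
From HB Require Import structures.
From mathcomp Require Import all_boot all_order all_algebra.
From mathcomp Require Import all_classical all_reals all_analysis.
From mathcomp Require Import measurable_realfun.
From mathcomp Require Import ring lra.
Import Order.TTheory GRing.Theory Num.Theory.
Import numFieldNormedType.Exports.
Local Open Scope classical_set_scope.
Local Open Scope ring_scope.
Set Implicit Arguments.
Unset Strict Implicit.
Unset Printing Implicit Defensive.

(** Let r = sqrt gamma and let H be the primitive of G^(-1/2) that vanishes at 0.
    As G is nondecreasing, H is concave, and as G^(-1/2) is not integrable, H is
    unbounded ([exists_concave_primitive]); hence h = H (sqrt gamma) is a
    continuous, nonnegative, proper function on M. If u does not attain its
    supremum then, for small eps > 0, the function u - eps * h attains its maximum
    at a point x outside any prescribed compact set, and u x is as close to the
    supremum as desired ([penalized_max]). In particular gamma x > 0 and the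
    bounds on gamma hold at x.

    Concavity replaces the differentiation of h: as H and the square root are
    concave and increasing, h lies below an affine function of gamma that agrees
    with it at x, namely
      h z - h x <= (gamma z - gamma x) / (2 r(x) G(r(x))^(1/2))
    for all z. Therefore x also maximizes u - lam * gamma, where
    lam = eps / (2 r(x) G(r(x))^(1/2)), and this function is of class C^2. At such
    a point the gradient of u is lam times that of gamma, and the weighted
    Laplacian of u is at most lam times that of gamma ([weighted_max_principle]).
    The bounds on gamma turn this into
      |grad u|(x) <= eps A / (2 G(r(x))^(1/2)) <= eps A / (2 G(0)^(1/2)),
      (Delta_f u)(x) <= eps B / 2,
    which are as small as desired. If u attains its supremum, the same principle
    with lam = 0 applies at a maximum point.

    The maximum principle at a point is proved in a chart. The Laplacian there is
    g^ij d_i d_j plus terms of first order ([laplacian_in_coordinates]); at a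
    maximum the matrix of second derivatives is negative semidefinite
    ([C2_max]), and its trace against the positive definite matrix g^ij is
    nonpositive ([trace_invmx_mul_le0]). *)

(** * Functions on the half-line *)

Section half_line_monotonicity.
Variables (R : realType) (G : R -> R).
Hypothesis slope_cvg :
  forall t, 0 <= t -> cvg (halfline_slope G t @ halfline_filter t).

Lemma halfline_continuous : {within `[0, +oo[, continuous G}.
Proof.
apply/subspace_continuousP => t /=; rewrite in_itv/= andbT => t0.
have FF : Filter (halfline_filter t) by rewrite /halfline_filter; typeclasses eauto.
have sub : (s - t) @[s --> halfline_filter t] --> (0 : R).
  have -> : (0 : R) = t - t by rewrite subrr.
  apply: cvgB; last exact: cvg_cst.
  by move=> A tA; apply: cvg_within; apply: cvg_within.
have := cvgM (slope_cvg t0) sub; rewrite mulr0 => /(_ FF)/cvgrPdist_lt Gt.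
apply/cvgrPdist_lt => e e0.
have near_t : nbhs t (fun s => s != t -> `[0, +oo[%classic s ->
    `|0 - halfline_slope G t s * (s - t)| < e) by exact: Gt.
suff : nbhs t (fun s => `[0, +oo[%classic s -> `|G t - G s| < e) by [].
apply: filterS near_t => s st s0.
have [->|sNt] := eqVneq s t; first by rewrite subrr normr0.
have := st sNt s0.
by rewrite sub0r normrN /halfline_slope divfK ?subr_eq0// distrC.
Qed.

(** At positive arguments the one-sided slopes are the two-sided ones, so that
    the calculus of the real line applies there. *)
Lemma halfline_is_derive (t : R) : 0 < t -> is_derive t 1 G (halfline_derive G t).
Proof.
move=> t0.
suff Gt : (fun h : R => h^-1 *: (G (h *: 1 + t) - G t)) @ 0^'
    --> halfline_derive G t.
  by apply: DeriveDef; [apply/cvg_ex; exists (halfline_derive G t)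
                       |exact: cvg_lim Gt].
have shift : (h + t) @[h --> (0 : R)^'] --> halfline_filter t.
  move=> A /nbhs_ballP[e/= e0 etA].
  apply/nbhs_ballP; exists (Num.min e t) => /=; first by rewrite lt_min e0.
  move=> h; rewrite /ball/= sub0r normrN lt_min => /andP[he ht] h0.
  apply: etA => /=.
  - by rewrite /ball/= distrC addrK.
  - by rewrite -subr_eq0 addrK.
  - by rewrite in_itv/= andbT -lerBlDr sub0r; move: ht; rewrite ltr_norml => /andP[/ltW].
have := cvg_comp _ _ shift (slope_cvg (ltW t0)).
apply: cvg_trans; apply: near_eq_cvg; near=> h.
by rewrite /halfline_slope/= addrK [h%:A]mulr1 mulrC.
Unshelve. all: by end_near. Qed.

Lemma halfline_nondecreasing :
  (forall t, 0 <= t -> 0 <= halfline_derive G t) ->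
  forall s t, 0 <= s -> s <= t -> G s <= G t.
Proof.
move=> dG; apply: ger0_derive1_ndecry halfline_continuous => t.
  by rewrite in_itv/= andbT => /halfline_is_derive.
rewrite in_itv/= andbT => t0.
by have dt := halfline_is_derive t0; rewrite derive1E derive_val dG// ltW.
Qed.

End half_line_monotonicity.

(** The primitive of g that vanishes at 0. It is concave because g is
    nonincreasing; concavity is expressed by the supporting lines of slope g s,
    and follows by comparing the increment of H over ]s, t] with the integrals of
    the constants g s and g t. H is unbounded because the increasing limit of the
    integrals over [0, m] is the integral over the half-line. *)
Lemma exists_concave_primitive (R : realType) (g : R -> R) :
  (forall t, 0 <= g t) -> {homo g : s t /~ s <= t} ->
  ~ integrable_at_pinfty g ->
  exists H : R -> R, [/\ (forall t, 0 <= H t),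
    (forall s t, 0 <= s -> 0 <= t -> H t - H s <= g s * (t - s)) &
    (forall K, exists T, forall t, T <= t -> K <= H t)].
Proof.
move=> g0 gni gnint.
pose mu := @lebesgue_measure R.
have mg D : measurable D -> measurable_fun D g.
  by move=> mD; apply: nonincreasing_measurable => // s t; exact: gni.
have ig a b : mu.-integrable `[a, b] (EFin \o g).
  apply: (@measurable_bounded_integrable _ (measurableTypeR R) R mu g) => //.
  - exact: (compact_finite_measure (@segment_compact R a b)).
  - exact: mg.
  - exists (g a); split; first exact: num_real.
    move=> K gaK t /=; rewrite in_itv/= => /andP[a_t _].
    by rewrite ger0_norm// (le_trans (gni _ _ a_t))// ltW.
pose H t := \int[mu]_(x in `[0, t]) g x.
have fin (a b : R) : fine (mu `]a, b]%classic) = Num.max 0 (b - a).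
  have -> : mu `]a, b]%classic = (if (a < b)%R then (b - a)%:E else 0)%E.
    by have := lebesgue_measure_itv `]a, b]; rewrite /= lte_fin EFinB.
  case: ltP => ab /=; last by rewrite max_l// subr_le0.
  by rewrite max_r ?subr_ge0// ltW.
have HB s t : 0 <= s -> s <= t ->
    H t - H s = \int[mu]_(x in `]s, t]) g x.
  by move=> s0 st; apply: Rintegral_itvB; rewrite ?bnd_simp//; exact: ig.
have igo a b : mu.-integrable `]a, b] (EFin \o g).
  by apply: integrableS (ig a b) => //; apply: subset_itvr; rewrite bnd_simp.
have icst a b r : mu.-integrable `]a, b] (EFin \o cst r).
  apply: (@measurable_bounded_integrable _ (measurableTypeR R) R mu (cst r)) => //.
  - apply: le_lt_trans (compact_finite_measure (@segment_compact R a b)).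
    by apply: le_measure; rewrite ?inE//; apply: subset_itvr; rewrite bnd_simp.
  - exists `|r|; split; first exact: num_real.
    by move=> K rK t /= _; exact: ltW.
have HM s t : 0 <= s -> s <= t -> g t * (t - s) <= H t - H s.
  move=> s0 st; rewrite HB//.
  have <- : \int[mu]_(x in `]s, t]) (g t) = g t * (t - s).
    by rewrite Rintegral_cst// fin max_r// subr_ge0.
  apply: (le_Rintegral _ (icst _ _ _) (igo _ _)) => // x /=; rewrite in_itv/= => /andP[_ xt].
  exact: gni.
have HM' s t : 0 <= s -> s <= t -> H t - H s <= g s * (t - s).
  move=> s0 st; rewrite HB//.
  have <- : \int[mu]_(x in `]s, t]) (g s) = g s * (t - s).
    by rewrite Rintegral_cst// fin max_r// subr_ge0.
  apply: (le_Rintegral _ (igo _ _) (icst _ _ _)) => // x /=; rewrite in_itv/= => /andP[/ltW sx _].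
  exact: gni.
have H0 t : 0 <= H t by apply: Rintegral_ge0 => x _; exact: g0.
exists H; split => //.
- move=> s t s0 t0; have [st|/ltW ts] := leP s t; first exact: HM'.
  by rewrite -lerN2 opprB -mulrN opprB HM.
- move=> K; apply: contrapT => /forallNP noT; apply: gnint; exists 0.
  apply/integrableP; split; first by apply/measurable_EFinP; apply: mg.
  have -> : (\int[mu]_(x in `[0%R, +oo[) `|(EFin \o g) x|
      = \int[mu]_(x in `[0%R, +oo[) (g x)%:E)%E.
    by apply: eq_integral => x _; rewrite gee0_abs// lee_fin.
  suff : (\int[mu]_(x in `[0%R, +oo[) (g x)%:E <= K%:E)%E.
    by move=> /le_lt_trans; apply; exact: ltry.
  have cvgI := @ge0_cvgn_integral R mu g g0 (mg _ measurableT).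
  rewrite -(cvg_lim _ cvgI)//; apply: lime_le; first exact: cvgP cvgI.
  apply: nearW => m.
  have -> : (\int[mu]_(x in `[0%R, m%:R]) (g x)%:E)%E = (H m%:R)%:E.
    by rewrite /H/= /Rintegral fineK//; exact: integrable_fin_num (ig _ _).
  have /existsNP[t /not_implyP[mt /negP]] := noT m%:R.
  rewrite -ltNge lee_fin => /ltW; apply: le_trans.
  rewrite -subr_ge0; apply: le_trans (HM _ _ (ler0n _ _) mt).
  by rewrite mulr_ge0// subr_ge0.
Qed.

(** * Positive definite matrices *)

Section positive_definite.
Variable R : rcfType.

(** Cholesky factorization, by induction on the size: splitting off the first
    coordinate leaves the Schur complement S - a^-1 q^T q, whose value at w is
    the value of P at the vector (- a^-1 w q^T, w). *)
Lemma posdef_factor n (P : 'M[R]_n) : P^T = P ->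
  (forall v : 'rV_n, v != 0 -> 0 < (v *m P *m v^T) 0 0) ->
  exists A : 'M[R]_n, P = A^T *m A.
Proof.
elim: n P => [|n IHn] P; first by exists 0; apply/matrixP => -[].
rewrite -[n.+1]/(1 + n)%N in P *.
rewrite -(submxK P).
set p := ulsubmx P; set q := ursubmx P; set q' := dlsubmx P; set S := drsubmx P.
rewrite tr_block_mx => /eq_block_mx[_ q'E qE SE] Ppos.
have -> : q' = q^T by [].
pose a := p 0 0.
have pE : p = a%:M by rewrite [LHS]mx11_scalar.
have a0 : 0 < a.
  have /(Ppos _) : row_mx 1%:M 0 != 0 :> 'rV[R]_(1 + n).
    apply/eqP => /(congr1 lsubmx); rewrite row_mxKl lsubmx_const.
    by move=> /matrixP/(_ 0 0)/eqP; rewrite !mxE oner_eq0.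
  rewrite mul_row_block !mul1mx !mul0mx !addr0 tr_row_mx trmx1 trmx0.
  by rewrite mul_row_col mulmx1 mulmx0 addr0.
have aN0 : a != 0 by rewrite gt_eqF.
have [||A' A'E] := IHn (S - a^-1 *: (q^T *m q)).
- by rewrite linearB/= linearZ/= trmx_mul trmxK SE.
- move=> w w0; pose c := - a^-1 *: (w *m q^T).
  have /(Ppos _) : row_mx c w != 0 :> 'rV[R]_(1 + n).
    by apply: contra_neq w0 => /(congr1 rsubmx); rewrite row_mxKr linear0.
  rewrite mul_row_block tr_row_mx mul_row_col.
  have -> : c *m p + w *m q' = 0.
    by rewrite -qE /c pE mul_mx_scalar scalerA mulrN divff// scaleN1r addNr.
  rewrite mul0mx add0r.
  suff -> : c *m q + w *m S = w *m (S - a^-1 *: (q^T *m q)) by [].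
  rewrite mulmxBr addrC /c -scalemxAl scaleNr -scalemxAr.
  by rewrite mulmxA.
exists (block_mx (Num.sqrt a)%:M ((Num.sqrt a)^-1 *: q) 0 A').
have sa2 : Num.sqrt a * Num.sqrt a = a by rewrite -expr2 sqr_sqrtr// ltW.
have saN0 : Num.sqrt a != 0 by rewrite sqrtr_eq0 -ltNge.
have trZ : ((Num.sqrt a)^-1 *: q)^T = (Num.sqrt a)^-1 *: q^T.
  by rewrite linearZ.
rewrite tr_block_mx mulmx_block trmx0 !mul0mx !mulmx0 !addr0 -A'E.
rewrite tr_scalar_mx -scalar_mxM sa2 -pE; congr block_mx.
- by rewrite mul_scalar_mx scalerA divff// scale1r.
- by rewrite trZ mul_mx_scalar scalerA divff// scale1r.
- rewrite trZ -scalemxAr -scalemxAl scalerA -invfM sa2.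
  by rewrite addrC subrK.
Qed.

Section posdef_consequences.
Variables (n : nat) (P : 'M[R]_n).
Hypothesis Psym : P^T = P.
Hypothesis Ppos : forall v : 'rV_n, v != 0 -> 0 < (v *m P *m v^T) 0 0.

Lemma posdef_unit : P \in unitmx.
Proof.
rewrite -row_free_unit; apply: inj_row_free => v vP0.
apply/eqP; apply: contraT => /Ppos; by rewrite vP0 mul0mx mxE ltxx.
Qed.

(** Since det (A^T A) = (det A)^2; this makes the square root of the determinant
    of the metric differentiable. *)
Lemma posdef_det_gt0 : 0 < \det P.
Proof.
have [A PE] := posdef_factor Psym Ppos.
rewrite lt_neqAle eq_sym -unitfE -unitmxE posdef_unit PE.
by rewrite det_mulmx det_tr -expr2 sqr_ge0.
Qed.

Lemma posdef_inv_sym : (invmx P)^T = invmx P.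
Proof. by rewrite trmx_inv Psym. Qed.

Lemma posdef_inv (v : 'rV_n) : v != 0 -> 0 < (v *m invmx P *m v^T) 0 0.
Proof.
move=> v0; have Pu := posdef_unit.
have /Ppos : v *m invmx P != 0.
  by apply: contra_neq v0 => /(congr1 (mulmx^~ P)); rewrite mulmxKV// mul0mx.
by rewrite mulmxKV// trmx_mul posdef_inv_sym mulmxA.
Qed.

(** If A^T A is the inverse of P, the trace is the sum of the values of the form H
    at the rows of A. *)
Lemma trace_invmx_mul_le0 (H : 'M[R]_n) :
  (forall v : 'rV_n, (v *m H *m v^T) 0 0 <= 0) -> \tr (invmx P *m H) <= 0.
Proof.
move=> Hneg; have [A ->] := posdef_factor posdef_inv_sym posdef_inv.
rewrite -mulmxA mxtrace_mulC; apply: sumr_le0 => i _.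
have := Hneg (row i A).
rewrite -row_mul tr_row mxE [X in _ -> X <= 0]mxE; congr (_ <= _).
by apply: eq_bigr => j _; rewrite !mxE.
Qed.

End posdef_consequences.
End positive_definite.

(** * Directional derivatives and maxima *)

Section directional_derivatives.
Variables (R : realType) (V : normedModType R).
Implicit Types (h : V -> R) (a b y z : V).

(** The next two lemmas pass between a derivative along a and the derivative of
    the restriction to a line, to which one-variable theorems apply. *)
Lemma is_derive_line h a z (s d : R) : is_derive (s *: a + z) a h d ->
  is_derive s 1 (fun t : R => h (t *: a + z)) d.
Proof.
move=> [dh <-].
have E : (fun k : R => k^-1 *: (h ((k *: (1 : R) + s) *: a + z) - h (s *: a + z)))
       = (fun k : R => k^-1 *: (h (k *: a + (s *: a + z)) - h (s *: a + z))).
  by apply/funext => k; rewrite [k%:A]mulr1 scalerDl addrA.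
by apply: DeriveDef; rewrite /derivable /derive E.
Qed.

Lemma is_derive_at_line h a z (d : R) :
  is_derive (0 : R) 1 (fun t : R => h (t *: a + z)) d -> is_derive z a h d.
Proof.
have E : (fun k : R => k^-1 *: (h ((k *: (1 : R) + 0) *: a + z) - h (0 *: a + z)))
       = (fun k : R => k^-1 *: (h (k *: a + z) - h z)).
  by apply/funext => k; rewrite addr0 scale0r add0r [k%:A]mulr1.
move=> [dh <-].
by apply: DeriveDef; move: dh; rewrite /derivable /derive E.
Qed.

Lemma is_derive_scale_dir h a z (c d : R) :
  is_derive z a h d -> is_derive z (c *: a) h (c * d).
Proof.
move=> dh; apply: is_derive_at_line.
have dl : is_derive (c * (0 : R)) 1 (fun t : R => h (t *: a + z)) d.
  by apply: is_derive_line; rewrite mulr0 scale0r add0r.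
have -> : (fun t : R => h (t *: (c *: a) + z)) =
    (fun t : R => h (t *: a + z)) \o ( *%R c).
  by apply/funext => t /=; rewrite scalerA mulrC.
have dm : is_derive (0 : R) 1 ( *%R c) c.
  have := @is_deriveZ _ _ _ id c (0 : R) 1 1 _.
  rewrite [c *: 1]mulr1; apply.
by rewrite mulrC; exact: is_derive1_comp.
Qed.

(** The mean value theorem between 0 and t, whatever the sign of t. *)
Lemma mean_value_sym (phi dphi : R -> R) (t : R) :
  (forall s : R, `|s| <= `|t| -> is_derive s 1 phi (dphi s)) ->
  exists2 s, `|s| <= `|t| & phi t - phi 0 = dphi s * t.
Proof.
move=> dphiP.
have cphi (p q : R) : (forall s, s \in `[p, q] -> `|s| <= `|t|) ->
    {within `[p, q], continuous phi}.
  move=> abt; apply: derivable_within_continuous => s /abt /dphiP[].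
  by [].
have [t0|t0|<-] := ltgtP 0 t; last by exists 0; rewrite ?lexx// subrr mulr0.
- have st s : s \in `[0, t] -> `|s| <= `|t|.
    by rewrite in_itv/= => /andP[s0 st]; rewrite !ger0_norm// ltW.
  have [s sI ->] := MVT t0 (fun s sI => dphiP s (st s (subset_itv_oo_cc sI)))
    (cphi _ _ st).
  by exists s; rewrite ?subr0//; apply: st; exact: subset_itv_oo_cc.
- have st s : s \in `[t, 0] -> `|s| <= `|t|.
    by rewrite in_itv/= => /andP[s0 st]; rewrite !ler0_norm ?lerN2// ltW.
  have [s sI E] := MVT t0 (fun s sI => dphiP s (st s (subset_itv_oo_cc sI)))
    (cphi _ _ st).
  exists s; first by apply: st; exact: subset_itv_oo_cc.
  by rewrite -opprB E sub0r mulrN opprK.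
Qed.

(** The increment along a + b is the increment along b followed by an increment
    along a; the latter starts at the moving point t *: b + y, and the mean value
    theorem with the continuity of the derivative along a absorbs this motion. *)
Lemma is_derive_add_dir h (Da : V -> R) a b y (db : R) :
  (\forall z \near y, is_derive z a h (Da z)) -> {for y, continuous Da} ->
  is_derive y b h db -> is_derive y (a + b) h (Da y + db).
Proof.
move=> dha cDa [dhb dbE].
pose Q (t : R) := t^-1 *: (h (t *: (a + b) + y) - h (t *: b + y)).
suff Qcvg : Q @ 0^' --> Da y.
  have S : (fun t : R => t^-1 *: (h (t *: (a + b) + y) - h y)) @ 0^'
      --> Da y + db.
    have -> : (fun t : R => t^-1 *: (h (t *: (a + b) + y) - h y)) =
        Q \+ (fun t => t^-1 *: (h (t *: b + y) - h y)).
      by apply/funext => t; rewrite /Q /= -scalerDr addrA subrK.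
    by apply: cvgD => //; rewrite -dbE; exact: dhb.
  by apply: DeriveDef; [apply/cvg_ex; exists (Da y + db) | exact: cvg_lim S].
apply/cvgrPdist_le => e e0.
have /nbhs_ballP[r/= r0 yrP] : nbhs y (fun z => is_derive z a h (Da z) /\
    `|Da y - Da z| <= e).
  by apply: filterI => //; move/cvgrPdist_le : cDa; exact.
have K0 : 0 < `|a| + `|b| + 1 by rewrite ltr_pwDr// addr_ge0.
apply/nbhs_ballP; exists (r / (`|a| + `|b| + 1)) => /=; first exact: divr_gt0.
move=> t; rewrite /ball/= sub0r normrN ltr_pdivlMr// => tr t0.
have near_seg s : `|s| <= `|t| -> is_derive (s *: a + (t *: b + y)) a h
      (Da (s *: a + (t *: b + y))) /\ `|Da y - Da (s *: a + (t *: b + y))| <= e.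
  move=> st; apply: yrP; rewrite -ball_normE/= addrA distrC addrK.
  rewrite (le_lt_trans _ tr)// (le_trans (ler_normD _ _))// !normrZ.
  rewrite !mulrDr mulr1 -[leLHS]addr0 lerD// lerD2r.
  exact: ler_wpM2r.
have [s /near_seg[_ Das]] := @mean_value_sym (fun s => h (s *: a + (t *: b + y)))
  (fun s => Da (s *: a + (t *: b + y))) t
  (fun s st => is_derive_line (near_seg s st).1).
rewrite scale0r add0r addrA -scalerDr => E.
rewrite /Q E [_ *: _]mulrC mulfK//.
Qed.

End directional_derivatives.

(** If c were positive, the derivative psi would be positive just to the right of
    0, where phi would then increase above its maximum. *)
Lemma second_derivative_test (R : realType) (phi psi : R -> R) (c : R) :
  (\forall t \near (0 : R), is_derive (t : R) 1 phi (psi t)) ->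
  is_derive (0 : R) 1 psi c -> (forall t, phi t <= phi 0) ->
  psi 0 = 0 /\ c <= 0.
Proof.
move=> /nbhs_ballP[r/= r0 dphi] dpsi phimax.
have dphi' (t : R) : `|t| < r -> forall s : R, `|s| <= `|t| ->
    is_derive s 1 phi (psi s).
  by move=> tr s st; apply: dphi; rewrite /ball/= sub0r normrN (le_lt_trans st).
have psi0 : psi 0 = 0.
  have d0 : is_derive (0 : R) 1 phi (psi 0) by apply: dphi; exact: ballxx.
  have [|||t tr|] := @derive1_at_max R phi (- r) r 0.
  - by rewrite (le_trans (y := 0))// ?oppr_le0 ltW.
  - by move=> t; rewrite in_itv/= -ltr_norml => tr;
      case: (dphi t) => //; rewrite /ball/= sub0r normrN.
  - by rewrite in_itv/= oppr_lt0 r0.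
  - exact: phimax.
  - by move=> _; rewrite derive_val.
split => //; rewrite leNgt; apply/negP => c0.
have [Q cE] : derivable psi 0 1 /\ 'D_1 psi 0 = c by case: dpsi.
have /cvgrPdist_lt/(_ c c0)/nbhs_ballP[d/= d0 dP] :
    (fun k : R => k^-1 *: (psi (k *: 1 + 0) - psi 0)) @ 0^' --> c.
  by rewrite -cE; exact: Q.
pose t := Num.min (r / 2) (d / 2).
have t0 : 0 < t by rewrite lt_min !divr_gt0.
have tr : `|t| < r.
  by rewrite gtr0_norm// gt_min ltr_pdivrMr// ltr_pMr// ltr1n.
have td : t < d.
  by rewrite gt_min orbC ltr_pdivrMr// ltr_pMr// ltr1n.
have dpos s : s \in `]0, t[ -> 0 < psi s.
  rewrite in_itv/= => /andP[s0 st].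
  have := dP s; rewrite /ball/= sub0r normrN gtr0_norm//.
  move=> /(_ (lt_trans st td) (lt0r_neq0 s0)).
  rewrite psi0 subr0 addr0 [s%:A]mulr1 ltr_distlC => /andP[+ _].
  by rewrite subrr pmulr_rgt0// invr_gt0.
have dphit (s : R) : s \in `[0, t] -> is_derive s 1 phi (psi s).
  rewrite in_itv/= => /andP[s0 st]; apply: (dphi' t tr).
  by rewrite !ger0_norm// ltW.
have cphi : {within `[0, t], continuous phi}.
  by apply: derivable_within_continuous => s /dphit[].
have [s sI E] := MVT t0 (fun s sI => dphit s (subset_itv_oo_cc sI)) cphi.
have := phimax t; rewrite -subr_le0 E subr0 leNgt => /negP; apply.
by rewrite mulr_gt0// dpos.
Qed.

Section euclidean.
Variables (R : realType) (n : nat) (U : set 'rV[R]_n).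
Hypothesis oU : open U.
Implicit Types (h : 'rV[R]_n -> R) (y a : 'rV[R]_n).

Lemma Ck_on_is_derive_partial k h y i : Ck_on k.+1 U h -> U y ->
  is_derive y (delta_mx 0 i) h (partial i h y).
Proof. by move=> [_ [dh _]] Uy; apply: DeriveDef => //; exact: dh. Qed.

Lemma Ck_on_partial k h i : Ck_on k.+1 U h -> Ck_on k U (partial i h).
Proof. by case=> _ [_]; exact. Qed.

Lemma Ck_on_continuous k h y : Ck_on k U h -> U y -> {for y, continuous h}.
Proof. by case: k => [|k] [ch _] Uy; apply: ch; rewrite inE. Qed.

(** Adding the coordinate directions one at a time with [is_derive_add_dir]. *)
Lemma C1_is_derive h y a : Ck_on 1 U h -> U y ->
  is_derive y a h (\sum_i a 0 i * partial i h y).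
Proof.
move=> C1h Uy; rewrite [in is_derive _ a](row_sum_delta a).
elim: (index_enum _) => [|i r IHr]; first by rewrite !big_nil; exact: is_derive0.
rewrite !big_cons.
apply: (is_derive_add_dir (Da := fun z => a 0 i * partial i h z)) => //.
  near=> z; apply: is_derive_scale_dir; apply: (Ck_on_is_derive_partial _ C1h).
  by near: z; exact: open_nbhs_nbhs.
apply: continuousM; first exact: cst_continuous.
exact: (Ck_on_continuous (Ck_on_partial i C1h) Uy).
Unshelve. all: by end_near. Qed.

Lemma C2_line h y a : Ck_on 2 U h -> U y ->
  (\forall t \near (0 : R), is_derive (t : R) 1 (fun s : R => h (s *: a + y))
     (\sum_i a 0 i * partial i h (t *: a + y))) /\
  is_derive (0 : R) 1 (fun t => \sum_i a 0 i * partial i h (t *: a + y))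
    (\sum_i a 0 i * \sum_j a 0 j * partial j (partial i h) y).
Proof.
move=> C2h Uy; split.
  have C1h : Ck_on 1 U h.
    by case: C2h => ch [dh d2h]; split => //; split => // i; case: (d2h i).
  have nU : \forall t \near (0 : R), U (t *: a + y).
    have cl : (fun t : R => t *: a + y) @ (0 : R) --> (0 : R) *: a + y.
      by apply: cvgD; [exact: cvgZr_tmp | exact: cvg_cst].
    by apply: cl; apply: open_nbhs_nbhs; split => //; rewrite scale0r add0r.
  by apply: filterS nU => t Ut; apply: is_derive_line; exact: C1_is_derive.
have -> : (fun t => \sum_i a 0 i * partial i h (t *: a + y)) =
    \sum_i (fun t : R => a 0 i *: partial i h (t *: a + y)).
  by apply/funext => t; rewrite fct_sumE.
apply: is_derive_sum => i; apply: is_deriveZ; apply: is_derive_line.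
by rewrite scale0r add0r; apply: C1_is_derive => //; exact: Ck_on_partial.
Qed.

(** First and second order conditions at a maximum of u - lam * g. Along
    each line through y they are those of a function of one variable, and
    [C2_line] expresses its derivatives by partial derivatives. *)
Lemma C2_max u g (lam : R) y : Ck_on 2 U u -> Ck_on 2 U g -> U y ->
  (forall z, u z - lam * g z <= u y - lam * g y) ->
  (forall i, partial i u y = lam * partial i g y) /\
  (forall a, \sum_i a 0 i * \sum_j a 0 j *
    (partial j (partial i u) y - lam * partial j (partial i g) y) <= 0).
Proof.
move=> C2u C2g Uy ymax.
have line a : \sum_i a 0 i * partial i u y = lam * \sum_i a 0 i * partial i g y
    /\ \sum_i a 0 i * \sum_j a 0 j *
    (partial j (partial i u) y - lam * partial j (partial i g) y) <= 0.
  have [du d2u] := C2_line a C2u Uy; have [dg d2g] := C2_line a C2g Uy.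
  have [||] := @second_derivative_test R
    (fun t => u (t *: a + y) - lam * g (t *: a + y))
    (fun t => \sum_i a 0 i * partial i u (t *: a + y) -
              lam * \sum_i a 0 i * partial i g (t *: a + y))
    (\sum_i a 0 i * (\sum_j a 0 j * partial j (partial i u) y) -
     lam * \sum_i a 0 i * (\sum_j a 0 j * partial j (partial i g) y)).
  - near=> t; apply: is_deriveB; first by near: t.
    by apply: is_deriveZ; near: t.
  - by rewrite scale0r add0r.
  rewrite scale0r add0r => /eqP; rewrite subr_eq0 => /eqP -> H; split => //.
  apply: le_trans H; rewrite mulr_sumr -sumrB; apply: ler_sum => i _.
  rewrite [lam * _]mulrCA -mulrBr [lam * _]mulr_sumr -sumrB.
  rewrite le_eqVlt; apply/orP; left; apply/eqP; congr (_ * _).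
  by apply: eq_bigr => j _; rewrite mulrBr [_ * (lam * _)]mulrCA.
split; last by move=> a; case: (line a).
move=> i; have [] := line (delta_mx 0 i).
have E h : \sum_k (delta_mx 0 i : 'rV[R]_n) 0 k * partial k h y = partial i h y.
  rewrite (bigD1 i)//= mxE !eqxx mul1r big1 ?addr0// => k ki.
  by rewrite mxE (negbTE ki) andbF mul0r.
by rewrite !E.
Unshelve. all: by end_near. Qed.

End euclidean.

(** * Derivatives of matrix functions *)

Section derivable_matrix.
Variables (R : realType) (V : normedModType R) (y e : V).

Lemma derivable_sum_fct (I : Type) (r : seq I) (P : pred I) (F : I -> V -> R) :
  (forall i, P i -> derivable (F i) y e) ->
  derivable (fun z => \sum_(i <- r | P i) F i z) y e.
Proof.
move=> dF; elim: r => [|i r IHr].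
  by under eq_fun do rewrite big_nil; exact: derivable_cst.
under eq_fun do rewrite big_cons.
by case: ifP => // Pi; apply: derivableD => //; exact: dF.
Qed.

Lemma derivable_prod_fct (I : Type) (r : seq I) (P : pred I) (F : I -> V -> R) :
  (forall i, P i -> derivable (F i) y e) ->
  derivable (fun z => \prod_(i <- r | P i) F i z) y e.
Proof.
move=> dF; elim: r => [|i r IHr].
  by under eq_fun do rewrite big_nil; exact: derivable_cst.
under eq_fun do rewrite big_cons.
by case: ifP => // Pi; apply: derivableM => //; exact: dF.
Qed.

Lemma derivable_det n (A : V -> 'M[R]_n) :
  (forall i j, derivable (fun z => A z i j) y e) ->
  derivable (fun z => \det (A z)) y e.
Proof.
move=> dA; apply: derivable_sum_fct => s _; apply: derivableM.
  exact: derivable_cst.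
exact: derivable_prod_fct.
Qed.

Lemma derivable_adj n (A : V -> 'M[R]_n) i j :
  (forall i j, derivable (fun z => A z i j) y e) ->
  derivable (fun z => (\adj (A z)) i j) y e.
Proof.
move=> dA; under eq_fun do rewrite mxE /cofactor.
apply: derivableM; first exact: derivable_cst.
by apply: derivable_det => k l; under eq_fun do rewrite !mxE; exact: dA.
Qed.

Lemma derivable_invmx n (A : V -> 'M[R]_n) i j :
  (\forall z \near y, A z \in unitmx) ->
  (forall i j, derivable (fun z => A z i j) y e) ->
  derivable (fun z => (invmx (A z)) i j) y e.
Proof.
move=> Au dA.
apply: (@near_eq_derivable _ _ _ (fun z => (\det (A z))^-1 * (\adj (A z)) i j)).
  by apply: filterS Au => z Az; rewrite /invmx Az [RHS]mxE.
apply: derivableM; last exact: derivable_adj.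
apply: derivableV; last exact: derivable_det.
by have := nbhs_singleton Au; rewrite unitmxE unitfE.
Qed.

Lemma derivable_sqrt (f : V -> R) : 0 < f y -> derivable f y e ->
  derivable (fun z => Num.sqrt (f z)) y e.
Proof.
move=> fy /derivable1P df; apply/derivable1P.
apply/derivable1_diffP.
apply: (@differentiable_comp _ _ _ _ (fun h : R => f (h *: e + y)) Num.sqrt).
  exact/derivable1_diffP.
apply/derivable1_diffP; rewrite scale0r add0r.
by case: (is_derive1_sqrt fy).
Qed.

End derivable_matrix.

(** * The maximum principle for the weighted Laplacian *)

(* These names of the atlas are also those of notions on finite types and
   vector spaces. *)
Local Notation codom := Defs.codom.
Local Notation coord := Defs.coord.

Section laplacian.
Variables (R : realType) (n : nat) (M : topologicalType).
Variable X : riemannian_manifold R n M.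
Implicit Types (c : chart R n M) (u g : M -> R).

Section in_a_chart.
Variables (c : chart R n M) (cX : atlas X c).

Lemma gram_unit y : codom c y -> gram X c y \in unitmx.
Proof. by move=> cy; apply: posdef_unit => v; exact: gram_posdef. Qed.

Lemma gram_det_gt0 y : codom c y -> 0 < \det (gram X c y).
Proof.
by move=> cy; apply: posdef_det_gt0 => [|v]; [exact: gram_sym|exact: gram_posdef].
Qed.

Lemma derivable_gram y i j k : codom c y ->
  derivable (fun z => gram X c z i j) y (delta_mx 0 k).
Proof. by move=> cy; have [_ [+ _]] := gram_smooth i j cX 1; apply. Qed.

Lemma derivable_sqrt_det_gram_inv y i j k : codom c y ->
  derivable (fun z => Num.sqrt (\det (gram X c z)) * invmx (gram X c z) i j)
    y (delta_mx 0 k).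
Proof.
move=> cy; apply: derivableM.
  apply: derivable_sqrt; first exact: gram_det_gt0.
  by apply: derivable_det => *; exact: derivable_gram.
apply: derivable_invmx => [|*]; last exact: derivable_gram.
near=> z; apply: gram_unit; near: z.
by apply: open_nbhs_nbhs; split => //; exact: codom_open.
Unshelve. all: by end_near. Qed.

(** The Laplacian has principal symbol g^ij and no term of order zero. The first
    order coefficients b are left unspecified: at a point where the
    gradients of two functions are proportional they contribute the same
    multiple of one another. *)
Lemma laplacian_in_coordinates y : codom c y ->
  exists b : 'I_n -> 'I_n -> R, forall u, Ck_on 2 (codom c) (u \o param c) ->
    div_in X c (grad_in X c u) y =
    \sum_i \sum_k (b i k * partial k (u \o param c) y +
      invmx (gram X c y) k i * partial i (partial k (u \o param c)) y).
Proof.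
move=> cy; set s := Num.sqrt (\det (gram X c y)).
pose w k i z := Num.sqrt (\det (gram X c z)) * invmx (gram X c z) k i.
have sN0 : s != 0 by rewrite sqrtr_eq0 -ltNge gram_det_gt0.
exists (fun i k => s^-1 * partial i (w k i) y) => u C2u.
rewrite /div_in -/s mulr_sumr; apply: eq_bigr => i _.
have -> : (fun z => Num.sqrt (\det (gram X c z)) * grad_in X c u z 0 i) =
    \sum_k (w k i * partial k (u \o param c)).
  apply/funext => z; rewrite fct_sumE /grad_in mxE mulr_sumr.
  by apply: eq_bigr => k _; rewrite mxE /w mulrCA mulrC.
have dw k : is_derive y (delta_mx 0 i) (w k i) (partial i (w k i) y).
  by apply: DeriveDef => //; exact: derivable_sqrt_det_gram_inv.
have du k : is_derive y (delta_mx 0 i) (partial k (u \o param c))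
    (partial i (partial k (u \o param c)) y).
  exact: (Ck_on_is_derive_partial _ (Ck_on_partial k C2u)).
rewrite [partial i _ y]derive_val mulr_sumr; apply: eq_bigr => k _.
rewrite /GRing.scale/= [w k i y]/w -/s.
by field.
Qed.

(** By [laplacian_in_coordinates] the difference of the two sides is the trace of
    the inverse of the metric times the second derivatives of u - lam * g. *)
Lemma laplacian_in_max u g (lam : R) y :
  Ck_on 2 (codom c) (u \o param c) -> Ck_on 2 (codom c) (g \o param c) ->
  codom c y -> (forall z, u z - lam * g z <= u (param c y) - lam * g (param c y)) ->
  grad_in X c u y = lam *: grad_in X c g y /\
  div_in X c (grad_in X c u) y <= lam * div_in X c (grad_in X c g) y.
Proof.
move=> C2u C2g cy ymax.
have [gradE hess] := C2_max (@codom_open _ _ _ c) C2u C2g cy (fun z => ymax (param c z)).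
split.
  by rewrite /grad_in scalemxAl; congr (_ *m _); apply/rowP => i; rewrite !mxE.
have [b lapE] := laplacian_in_coordinates cy.
rewrite !lapE// -subr_le0 mulr_sumr -sumrB.
pose H : 'M[R]_n := \matrix_(i, k) (partial i (partial k (u \o param c)) y -
  lam * partial i (partial k (g \o param c)) y).
suff -> : \sum_i (\sum_k (b i k * partial k (u \o param c) y +
      invmx (gram X c y) k i * partial i (partial k (u \o param c)) y) -
    lam * \sum_k (b i k * partial k (g \o param c) y +
      invmx (gram X c y) k i * partial i (partial k (g \o param c)) y)) =
    \tr (invmx (gram X c y) *m H).
  apply: trace_invmx_mul_le0 => [|v|v]; [exact: gram_sym|exact: gram_posdef|].
  apply: le_trans (hess v); rewrite le_eqVlt; apply/orP; left; apply/eqP.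
  rewrite mxE; apply: eq_bigr => k _; rewrite !mxE mulrC; congr (_ * _).
  by apply: eq_bigr => i _; rewrite mxE.
rewrite mxtrace_mulC; apply: eq_bigr => i _.
rewrite mxE mulr_sumr -sumrB; apply: eq_bigr => k _.
by rewrite mxE gradE; ring.
Qed.

End in_a_chart.

Lemma chart_atP (x : M) : atlas X (chart_at X x) /\ dom (chart_at X x) x.
Proof. by rewrite /chart_at; case: cid2. Qed.

(** The weight adds a term of first order, which matches on both sides because
    the gradient of u at x is lam times that of g. *)
Lemma weighted_max_principle f u g (lam : R) x : Ck X 2 u -> Ck X 2 g -> 0 <= lam ->
  (forall z, u z - lam * g z <= u x - lam * g x) ->
  tnorm X x (grad X u x) = lam * tnorm X x (grad X g x) /\
  weighted_laplacian X f u x <= lam * weighted_laplacian X f g x.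
Proof.
move=> C2u C2g lam0 xmax; have [cX cx] := chart_atP x.
have cy : codom (chart_at X x) (coord (chart_at X x) x) by exists x.
have [|gE lE] := laplacian_in_max cX (C2u _ cX) (C2g _ cX) cy (lam := lam).
  by move=> z; rewrite coordK ?inE.
have gradE : grad X u x = lam *: grad X g x by [].
have innerZ v w a : inner X x v (a *: w) = a * inner X x v w.
  by rewrite /inner linearZ/= -scalemxAr mxE.
have innerZl v w a : inner X x (a *: v) w = a * inner X x v w.
  by rewrite /inner -!scalemxAl mxE.
split.
  rewrite /tnorm gradE innerZ innerZl mulrA -expr2 sqrtrM ?sqr_ge0//.
  by rewrite sqrtr_sqr ger0_norm.
by rewrite /weighted_laplacian gradE innerZ mulrBr lerB.
Qed.

Lemma Ck_continuous k u : Ck X k u -> continuous u.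
Proof.
move=> Cu x; have [cX cx] := chart_atP x.
set c := chart_at X x in cX cx.
have cc : {for coord c x, continuous (u \o param c)}.
  by apply: (Ck_on_continuous (Cu c cX)); exists x.
have co : {for x, continuous (coord c)} by apply: Defs.coord_continuous; rewrite inE.
have uc : (u \o param c) \o coord c @ x --> u x.
  have -> : u x = (u \o param c) (coord c x) by rewrite /= coordK ?inE.
  exact: cvg_comp co cc.
apply: cvg_trans uc; apply: near_eq_cvg.
have : nbhs x (dom c) by apply: open_nbhs_nbhs; split => //; exact: dom_open.
by apply: filterS => z cz /=; rewrite coordK ?inE.
Qed.

End laplacian.

(** * The Omori-Yau maximum principle *)

(** Subtracting a small multiple of a proper function produces a maximum. When s
    is not attained, u stays below some m < s on the compact set K, so starting
    from a value of u close enough to s the maximum must fall outside K. *)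
Lemma penalized_max (R : realType) (M : topologicalType) (u h : M -> R)
    (K : set M) (s delta eta : R) :
  continuous u -> continuous h -> (forall x, 0 <= h x) ->
  (forall b, exists2 C, compact C & forall x, ~ C x -> b <= h x) ->
  compact K -> (forall x, u x < s) -> (forall t, t < s -> exists x, t < u x) ->
  0 < delta -> 0 < eta ->
  exists eps x, [/\ 0 < eps <= eta, ~ K x, s - delta < u x &
    forall z, u z - eps * h z <= u x - eps * h x].
Proof.
move=> cu ch h0 hproper cK us sup_u d0 eta0.
have [m ms mK] : exists2 m, m < s & forall x, K x -> u x <= m.
  have [[x Kx]|nK] := pselect (K !=set0); last first.
    by exists (s - 1); [rewrite ltrBlDr ltrDl|move=> x Kx; case: nK; exists x].
  have [|p pK pmax] := compact_EVT_max _ cK (continuous_subspaceT cu).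
    by exists x.
  by exists (u p) => // z Kz; apply: pmax; rewrite inE.
pose l := Num.max m (s - delta).
have [|y ly] := sup_u l; first by rewrite gt_max ms ltrBlDr ltrDl.
have hy0 : 0 < h y + 1 by rewrite ltr_wpDl.
(* The shift by 1 covers h y = 0 and makes [lw] strict. *)
pose eps := Num.min eta ((u y - l) / (h y + 1)).
have eps0 : 0 < eps by rewrite lt_min eta0 divr_gt0 ?subr_gt0.
pose w z := u z - eps * h z.
have lw : l < w y.
  have : eps * (h y + 1) <= u y - l by rewrite -ler_pdivlMr// ge_min lexx orbT.
  rewrite /w; lra.
have [C cC hC] := hproper ((s - w y) / eps).
have wC z : ~ C z -> w z <= w y.
  move=> /hC; rewrite ler_pdivrMr// mulrC => b; have := us z; rewrite {1}/w; lra.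
have cw : continuous w.
  by move=> z; apply: cvgB; [exact: cu|apply: cvgM; [exact: cvg_cst|exact: ch]].
have [||x _ xmax] := @compact_EVT_max _ _ w (C `|` [set y]) _ _
    (continuous_subspaceT cw).
- by exists y; right.
- by apply: compactU => //; exact: compact_set1.
have xmaxT z : w z <= w x.
  have yx : w y <= w x by apply: xmax; rewrite inE; right.
  have [Cz|/wC/le_trans] := pselect (C z); last exact.
  by apply: xmax; rewrite inE; left.
have lux : l < u x.
  apply: lt_le_trans lw (le_trans (xmaxT y) _).
  by rewrite lerBlDr lerDl mulr_ge0// ltW.
exists eps, x; split => //.
- by rewrite eps0 ge_min lexx.
- by move=> /mK; rewrite leNgt (le_lt_trans _ lux)// le_max lexx.
- by rewrite (le_lt_trans _ lux)// le_max lexx orbT.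
Qed.

Lemma sqrtr_concave (R : rcfType) (a b : R) : 0 < a -> 0 <= b ->
  Num.sqrt b - Num.sqrt a <= (b - a) / (2 * Num.sqrt a).
Proof.
move=> a0 b0; have sa0 : 0 < Num.sqrt a by rewrite sqrtr_gt0.
rewrite ler_pdivlMr ?mulr_gt0//.
have := sqr_sqrtr b0; have := sqr_sqrtr (ltW a0).
have := sqr_ge0 (Num.sqrt b - Num.sqrt a); nra.
Qed.

(** Exchanging s and t makes the bound two-sided, so that H is Lipschitz on
    [0, +oo[; composing with r >= 0 avoids the negative arguments. *)
Lemma slope_bound_continuous (R : realType) (M : topologicalType) (H : R -> R)
    (L : R) (r : M -> R) :
  (forall s t, 0 <= s -> 0 <= t -> H t - H s <= L * `|t - s|) ->
  (forall x, 0 <= r x) -> continuous r -> continuous (H \o r).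
Proof.
move=> HL r0 cr x; apply/cvgrPdist_lt => e e0.
have L0 : 0 < `|L| + 1 by rewrite ltr_wpDl.
have /cvgrPdist_lt/(_ (e / (`|L| + 1))) := cr x.
rewrite divr_gt0// => /(_ isT); apply: filterS => z.
rewrite ltr_pdivlMr// => rz.
have Hb s t : 0 <= s -> 0 <= t -> H t - H s <= (`|L| + 1) * `|t - s|.
  move=> s0 t0; apply: le_trans (HL _ _ s0 t0) _; apply: ler_wpM2r => //.
  by rewrite (le_trans (ler_norm _))// lerDl.
apply: le_lt_trans rz; rewrite mulrC /= ler_norml.
rewrite Hb// andbT -lerN2 opprK opprB.
by rewrite distrC Hb.
Qed.

Theorem theorem4p1 (R : realType) (n : nat) (M : topologicalType)
  (X : riemannian_manifold R n M)
  (M_nonempty : [set: M] !=set0) (M_connected : connected [set: M])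
  (f : M -> R) (f_smooth : smooth X f)
  (G : R -> R) (G_smooth : halfline_smooth G)
  (G0_gt0 : 0 < G 0)
  (G'_ge0 : forall t : R, 0 <= t -> 0 <= halfline_derive G t)
  (G_nonintegrable :
    ~ integrable_at_pinfty (fun t : R => (Num.sqrt (G t))^-1))
  (G_limsup :
    (limf_esup (fun t : R => (t * G (Num.sqrt t) / G t)%:E) +oo%R < +oo)%E)
  (gamma : M -> R) (gamma_C2 : Ck X 2 gamma)
  (gamma_ge0 : forall x, 0 <= gamma x)
  (gamma_infty : gamma x @[x --> at_infinity M] --> +oo)
  (grad_gamma : exists2 A : R, 0 < A &
    \forall x \near at_infinity M,
      tnorm X x (grad X gamma x) <= A * Num.sqrt (gamma x))
  (lap_gamma : exists2 B : R, 0 < B &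
    \forall x \near at_infinity M,
      weighted_laplacian X f gamma x
        <= B * Num.sqrt (gamma x) * Num.sqrt (G (Num.sqrt (gamma x))))
  (grad_f : exists2 C : R, 0 < C &
    forall x, tnorm X x (grad X f x) <= C * Num.sqrt (G (Num.sqrt (gamma x)))) :
  forall u : M -> R, Ck X 2 u -> has_ubound (range u) ->
  exists x_ : nat -> M, forall k : nat, (0 < k)%N ->
    [/\ u (x_ k) > sup (range u) - k%:R^-1,
        tnorm X (x_ k) (grad X u (x_ k)) < k%:R^-1
      & weighted_laplacian X f u (x_ k) < k%:R^-1].
Proof.
move=> u C2u u_ub.
have slope_cvg t : 0 <= t -> cvg (halfline_slope G t @ halfline_filter t).
  exact: (G_smooth 0%N).
have Gmono := halfline_nondecreasing slope_cvg G'_ge0.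
have Gpos t : 0 <= t -> 0 < G t.
  by move=> t0; apply: lt_le_trans G0_gt0 _; exact: Gmono.
(* Extended by its value at 0, so as to be nonincreasing on the whole line. *)
pose g t := (Num.sqrt (G (Num.max t 0)))^-1.
have max_ge0 (t : R) : 0 <= Num.max t 0 by rewrite le_max lexx orbT.
have g0 t : 0 < g t by rewrite invr_gt0 sqrtr_gt0 Gpos.
have gni : {homo g : s t /~ s <= t}.
  move=> s t st; rewrite lef_pV2 ?posrE ?sqrtr_gt0 ?Gpos// ler_wsqrtr//.
  by apply: Gmono => //; rewrite ge_max !le_max st lexx !orbT.
have gE t : 0 <= t -> g t = (Num.sqrt (G t))^-1 by move=> t0; rewrite /g max_l.
have g_nint : ~ integrable_at_pinfty g.
  move=> [a ga]; apply: G_nonintegrable; exists (Num.max a 0).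
  have : (@lebesgue_measure R).-integrable `[Num.max a 0, +oo[ (EFin \o g).
    apply: integrableS ga => //; apply: subset_itvr.
    by rewrite bnd_simp le_max lexx.
  apply: eq_integrable => // t; rewrite inE/= in_itv/= andbT ge_max => /andP[_ t0].
  by rewrite gE.
have [H [H0 Hconc Hunb]] := exists_concave_primitive (fun t => ltW (g0 t)) gni g_nint.
pose r x := Num.sqrt (gamma x).
have r0 x : 0 <= r x by exact: sqrtr_ge0.
have cr : continuous r.
  move=> x; apply: continuous_comp; first exact: Ck_continuous gamma_C2 x.
  exact: sqrt_continuous.
have ch : continuous (H \o r).
  apply: (@slope_bound_continuous _ _ _ (g 0)) => // s t s0 t0.
  apply: le_trans (Hconc _ _ s0 t0) _.
  apply: (le_trans (y := g s * `|t - s|)).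
    by apply: ler_wpM2l; [exact: ltW | exact: ler_norm].
  by apply: ler_wpM2r => //; exact: gni.
have gamma_large b : exists2 C, compact C & forall x, ~ C x -> b < gamma x.
  have [|C cC Cb] := gamma_infty [set t | b < t].
    by apply: nbhs_pinfty_gt; exact: num_real.
  by exists C.
have h_proper b : exists2 C, compact C & forall x, ~ C x -> b <= (H \o r) x.
  have [T HT] := Hunb b; have [C cC Cg] := gamma_large (T ^+ 2).
  exists C => // x /Cg /ltW Tg; apply: HT.
  by rewrite (le_trans (ler_norm T))// -sqrtr_sqr ler_wsqrtr.
have u_sup : has_sup (range u).
  by split => //; case: M_nonempty => x _; exists (u x), x.
suff key (d : R) : 0 < d -> exists x,
    [/\ u x > sup (range u) - d, tnorm X x (grad X u x) < d
      & weighted_laplacian X f u x < d].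
  have [x0 _] := M_nonempty.
  (* No condition is imposed at index 0, where x0 is a default value. *)
  have pt (k : nat) : exists x, (0 < k)%N ->
      [/\ u x > sup (range u) - k%:R^-1, tnorm X x (grad X u x) < k%:R^-1
        & weighted_laplacian X f u x < k%:R^-1].
    have [->|k0] := posnP k; first by exists x0.
    by have [|x xP] := key k%:R^-1; [rewrite invr_gt0 ltr0n | exists x].
  by have [x_ x_P] := choice pt; exists x_.
move=> d0.
have u_le x : u x <= sup (range u) by apply: ub_le_sup => //; exists x.
(* If the supremum is attained, lam = 0 gives a critical point at once. *)
have [[x ux]|u_lt] := pselect (exists x, u x = sup (range u)).
  have [|tE wE] := weighted_max_principle f C2u gamma_C2 (lexx 0) (x := x).
    by move=> z; rewrite !mul0r !subr0 ux.
  by exists x; rewrite tE mul0r ux ltrBlDr ltrDl; split => //;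
    rewrite (le_lt_trans wE)// mul0r.
have {}u_lt x : u x < sup (range u).
  by rewrite lt_neqAle u_le andbT; apply/eqP => ux; apply: u_lt; exists x.
have [A A0 [K1 cK1 KA]] := grad_gamma.
have [B B0 [K2 cK2 KB]] := lap_gamma.
have [K3 cK3 Kg] := gamma_large 0.
pose G0s := Num.sqrt (G 0); have G0s0 : 0 < G0s by rewrite sqrtr_gt0.
(* With eps <= eta the two bounds obtained below are at most d / 2. *)
pose eta := Num.min (d * G0s / A) (d / B).
have eta0 : 0 < eta by rewrite lt_min !divr_gt0// mulr_gt0.
have cK : compact (K1 `|` K2 `|` K3) by apply: compactU => //; exact: compactU.
have [|eps [x [/andP[eps0 eps_eta] xK xd xmax]]] := penalized_max
    (Ck_continuous C2u) ch (fun x => H0 (r x)) h_proper cK u_lt _ d0 eta0.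
  by move=> t /(sup_gt u_sup.1)[_ [x _ <-] tx]; exists x.
have {}KA : tnorm X x (grad X gamma x) <= A * r x.
  by apply: KA => xK1; apply: xK; left; left.
have {}KB : weighted_laplacian X f gamma x <= B * r x * Num.sqrt (G (r x)).
  by apply: KB => xK2; apply: xK; left; right.
have gx0 : 0 < gamma x by apply: Kg => xK3; apply: xK; right.
have rx0 : 0 < r x by rewrite sqrtr_gt0.
set q := Num.sqrt (G (r x)) in KB.
have q0 : 0 < q by rewrite sqrtr_gt0 Gpos.
have G0q : G0s <= q by rewrite ler_wsqrtr// Gmono.
(* eps times the slope at gamma x of the concave function t |-> H (sqrt t). *)
pose lam := eps / (2 * r x * q).
have lam0 : 0 <= lam by rewrite divr_ge0 ?mulr_ge0// ltW.
have [|tE wE] := weighted_max_principle f C2u gamma_C2 lam0 (x := x).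
  move=> z.
  have h_le : H (r z) - H (r x) <= q^-1 * ((gamma z - gamma x) / (2 * r x)).
    apply: le_trans (Hconc _ _ (r0 x) (r0 z)) _.
    by rewrite gE// ler_pM2l ?invr_gt0// sqrtr_concave.
  have : eps * (H (r z) - H (r x)) <= lam * (gamma z - gamma x).
    apply: le_trans (_ : eps * (q^-1 * ((gamma z - gamma x) / (2 * r x))) <= _).
      by rewrite ler_pM2l.
    rewrite le_eqVlt; apply/orP; left; apply/eqP; rewrite /lam.
    by field; rewrite !gt_eqF.
  by have := xmax z; rewrite /=; lra.
have epsA : eps * A <= d * G0s.
  by rewrite -ler_pdivlMr// (le_trans eps_eta)// ge_min lexx.
have epsB : eps * B <= d.
  by rewrite -ler_pdivlMr// (le_trans eps_eta)// ge_min lexx orbT.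
exists x; split => //.
- rewrite tE; apply: le_lt_trans (_ : lam * (A * r x) < d).
    by rewrite ler_wpM2l.
  have -> : lam * (A * r x) = eps * A / (2 * q).
    by rewrite /lam; field; rewrite !gt_eqF.
  rewrite ltr_pdivrMr ?mulr_gt0//; nra.
- apply: le_lt_trans wE _; apply: le_lt_trans (_ : lam * (B * r x * q) < d).
    by rewrite ler_wpM2l.
  have -> : lam * (B * r x * q) = eps * B / 2.
    by rewrite /lam; field; rewrite !gt_eqF.
  lra.
Qed.
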